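(* Let $G$ be a monoid, let $A$ be a $G$-act, and let $S=\bigoplus_{g\in G}S_g$ be a $G$-graded ring. Then the functors $\Phi$ and $\Psi$ (defined in the context) are mutually inverse and give an isomorphism of categories $$(G{\int}_S A)\text{-}\mathbf{Mod}\;\cong\; A\text{-gr } S\text{-}\mathbf{Mod}$$ between the category of $G{\int}_S A$-modules and the category of $A$-graded $S$-modules.
   Context: A (left) $G$-act over a monoid $G$ is a set $A$ with an operation $G\times A\to A$ satisfying $(gh)a=g(ha)$ and $1_G a=a$. A $G$-graded ring is a (unital, associative) ring $S=\bigoplus_{g\in G}S_g$ with $S_gS_h\subseteq S_{gh}$ and $1_S\in S_{1_G}$. The action category over $S$, denoted $G{\int}_S A$, is the preadditive category with object set $A$, whose morphisms $a\to b$ are pairs $(a,s)$ with $s\in\bigoplus_{g\in G,\ ga=b}S_g$ (added in the second component); composition is $(b,t)\circ(a,s)=(a,ts)$ for $(a,s)\colon a\to b$ and $(b,t)\colon b\to c$. For a small preadditive category $\mathcal A$, an $\mathcal A$-module is an additive functor $\mathcal A\to\mathbf{Ab}$; morphisms are natural transformations. An $A$-graded $S$-module is a (left) $S$-module $M$ with a decomposition $M=\bigoplus_{a\in A}M_a$ into Abelian groups such that $S_gM_a\subseteq M_{ga}$ for all $g\in G$, $a\in A$. Morphisms are $S$-linear maps $f$ with $f(M_a)\subseteq N_a$ for all $a\in A$. The functor $\Phi$ sends a $G{\int}_S A$-module $M$ to $\Phi M=\bigoplus_{a\in A}M(a)$ with grading $(\Phi M)_a=M(a)$ and $S$-action determined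 by $sm=M((a,s))(m)$ for $s\in S_g$, $m\in M(a)$; on morphisms $(\Phi f)_a=f_a$. The functor $\Psi$ sends an $A$-graded $S$-module $Q$ to the functor with $(\Psi Q)(a)=Q_a$ and $(\Psi Q)((a,s))(q)=sq$ for $q\in Q_a$; on morphisms $(\Psi h)_a=h_a$. (Direct sums are identified with internal direct sums of their summands.) *)

(* Defs.v *)
From HB Require Import structures.
From mathcomp Require Import all_boot all_order all_algebra.
From mathcomp Require Import finmap boolp classical_sets.
From mathcomp Require Import functions cardinality fsbigop.

Set Implicit Arguments.
Unset Strict Implicit.
Unset Printing Implicit Defensive.
Import GRing.Theory.
Local Open Scope classical_set_scope.
Local Open Scope ring_scope.

Lemma additive_eq (U V : zmodType) (f g : {additive U -> V}) : f =1 g -> f = g.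
Proof.
case: f g => [f [[mf]]] [g [[mg]]] /= /funext fg; case: _ / fg mg => mg.
by rewrite (Prop_irrelevance mf mg).
Qed.

Section DirectSum.
Variables (I : choiceType) (M : I -> zmodType).

(* The external direct sum: finitely supported dependent families. *)
Record dsum := DSum {
  dsum_fun :> forall i, M i;
  dsum_finite : finite_set [set i | dsum_fun i != 0] }.

HB.instance Definition _ := gen_eqMixin dsum.
HB.instance Definition _ := gen_choiceMixin dsum.

Lemma dsumP (x y : dsum) : (forall i, x i = y i) -> x = y.
Proof.
case: x y => [x fx] [y fy] /= xy.
have {}xy : x = y by apply: functional_extensionality_dep.
by case: _ / xy fy => fy; rewrite (Prop_irrelevance fx fy).
Qed.

Lemma dsum0_finite : finite_set [set i | (0 : M i) != 0].
Proof.
rewrite (_ : [set _ | _] = set0)//.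
by apply/seteqP; split=> i //=; rewrite eqxx.
Qed.

Lemma dsumN_finite (x : dsum) : finite_set [set i | - x i != 0].
Proof.
by apply: sub_finite_set (dsum_finite x) => i /=; rewrite oppr_eq0.
Qed.

Lemma dsumD_finite (x y : dsum) : finite_set [set i | x i + y i != 0].
Proof.
have : finite_set ([set i | x i != 0] `|` [set i | y i != 0]).
  by rewrite finite_setU; split; apply: dsum_finite.
apply: sub_finite_set => i /=; have [->|] := eqVneq (x i) 0; last by left.
by rewrite add0r; right.
Qed.

Definition dsum0 := DSum dsum0_finite.
Definition dsumN x := DSum (dsumN_finite x).
Definition dsumD x y := DSum (dsumD_finite x y).

Fact dsumDA : associative dsumD.
Proof. by move=> x y z; apply: dsumP => i /=; rewrite addrA. Qed.
Fact dsumDC : commutative dsumD.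
Proof. by move=> x y; apply: dsumP => i /=; rewrite addrC. Qed.
Fact dsum0D : left_id dsum0 dsumD.
Proof. by move=> x; apply: dsumP => i /=; rewrite add0r. Qed.
Fact dsumND : left_inverse dsum0 dsumN dsumD.
Proof. by move=> x; apply: dsumP => i /=; rewrite addNr. Qed.

HB.instance Definition _ :=
  GRing.isZmodule.Build dsum dsumDA dsumDC dsum0D dsumND.

Lemma dsum0E i : (0 : dsum) i = 0. Proof. by []. Qed.
Lemma dsumNE (x : dsum) i : (- x) i = - x i. Proof. by []. Qed.
Lemma dsumDE (x y : dsum) i : (x + y) i = x i + y i. Proof. by []. Qed.

Section Inclusion.
Variable i : I.

Lemma dsum_in_finite (m : M i) :
  finite_set [set j | dfwith (fun j => 0 : M j) m j != 0].
Proof.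
apply: (@sub_finite_set _ _ [set i]); last exact: finite_set1.
by move=> j /=; case: dfwithP => [|j' _] //; rewrite eqxx.
Qed.

Definition dsum_in m := DSum (dsum_in_finite m).

Lemma dsum_inE m : dsum_in m i = m.
Proof. by rewrite /= dfwith_in. Qed.

Lemma dsum_in_out m j : i != j -> dsum_in m j = 0.
Proof. by move=> ij; rewrite /= dfwith_out. Qed.

Fact dsum_in_is_zmod_morphism : zmod_morphism dsum_in.
Proof.
move=> m n; apply: dsumP => j; rewrite dsumDE dsumNE.
have [<-|ij] := eqVneq i j; first by rewrite !dsum_inE.
by rewrite !dsum_in_out// subrr.
Qed.
HB.instance Definition _ :=
  GRing.isZmodMorphism.Build (M i) dsum dsum_in dsum_in_is_zmod_morphism.

End Inclusion.

Lemma dsum_sum J (r : seq J) (P : pred J) (F : J -> dsum) i :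
  (\sum_(j <- r | P j) F j) i = \sum_(j <- r | P j) F j i.
Proof. by elim/big_rec2: _ => // j y x _ <-. Qed.

Definition supp (x : dsum) : {fset I} := fset_set [set i | x i != 0].

Lemma in_supp (x : dsum) i : (i \in supp x) = (x i != 0).
Proof.
by rewrite in_fset_set; [rewrite mem_setE|exact: dsum_finite].
Qed.

Lemma dsum_decomp (x : dsum) : x = \sum_(i <- supp x) dsum_in (x i).
Proof.
apply: dsumP => i; rewrite dsum_sum.
have [xi0|xi0] := eqVneq (x i) 0.
  rewrite xi0 big1// => j _; have [->|ji] := eqVneq j i.
    by rewrite dsum_inE.
  by rewrite dsum_in_out.
rewrite (bigD1_seq i) ?fset_uniq ?in_supp// dsum_inE big1 => [|j ji].
  exact/esym/addr0.
by rewrite dsum_in_out.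
Qed.

Lemma dsum_ind (P : dsum -> Prop) :
    P 0 -> (forall x y, P x -> P y -> P (x + y)) ->
    (forall i m, P (dsum_in (i := i) m)) ->
  forall x, P x.
Proof. by move=> P0 PD Pin x; rewrite (dsum_decomp x); apply: big_ind. Qed.

Variables (V : zmodType) (f : forall i, {additive M i -> V}).

Definition dsum_lift (x : dsum) : V := \sum_(i \in [set: I]) f i (x i).

Lemma dsum_liftE (A : {fset I}) (x : dsum) :
  (supp x `<=` A)%fset -> dsum_lift x = \sum_(i <- A) f i (x i).
Proof.
move=> /fsubsetP xA; rewrite /dsum_lift (@fsbigTE _ _ _ _ A)// => i iA.
suff -> : x i = 0 by rewrite raddf0.
by apply/eqP; apply: contraNT iA => xi0; apply: xA; rewrite in_supp.
Qed.

Fact dsum_lift_is_zmod_morphism : zmod_morphism dsum_lift.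
Proof.
move=> x y; pose A := (supp x `|` supp y `|` supp (x - y))%fset.
rewrite !(@dsum_liftE A).
- by rewrite -sumrB; apply: eq_bigr => i _; rewrite -raddfB.
- by apply/fsubsetP => i ix; rewrite !inE ix ?orbT.
- by apply/fsubsetP => i ix; rewrite !inE ix ?orbT.
- by apply/fsubsetP => i ix; rewrite !inE ix ?orbT.
Qed.
HB.instance Definition _ :=
  GRing.isZmodMorphism.Build dsum V dsum_lift dsum_lift_is_zmod_morphism.

Lemma dsum_lift_in i (m : M i) : dsum_lift (dsum_in m) = f i m.
Proof.
rewrite (@dsum_liftE [fset i]%fset) ?big_seq_fset1 ?dsum_inE//.
apply/fsubsetP => j; rewrite in_supp inE; have [//|ji] := eqVneq j i.
by rewrite dsum_in_out ?eqxx// eq_sym.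
Qed.

End DirectSum.

Lemma dsum_ext (I : choiceType) (M : I -> zmodType) (V : zmodType)
    (f g : {additive dsum M -> V}) :
  (forall i (m : M i), f (dsum_in m) = g (dsum_in m)) -> f =1 g.
Proof.
move=> fg; apply: dsum_ind => [|x y fgx fgy|//]; first by rewrite !raddf0.
by rewrite !raddfD fgx fgy.
Qed.

Definition subgrp (V : zmodType) (P : zmodClosed V) := {x : V | x \in P}.
HB.instance Definition _ V P := SubChoice.on (@subgrp V P).
HB.instance Definition _ V (P : zmodClosed V) :=
  [SubChoice_isSubZmodule of subgrp P by <:].

Definition to_subgrp (V : zmodType) (P : zmodClosed V) x (Px : x \in P) :
  subgrp P := exist _ x Px.

Definition subgrp_val (V : zmodType) (P : zmodClosed V) :
  {additive subgrp P -> V} := val.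

Definition internal_sum (I : choiceType) (V : zmodType)
    (V_ : I -> zmodClosed V) : {additive dsum (fun i => subgrp (V_ i)) -> V} :=
  dsum_lift (fun i => subgrp_val (V_ i)).

Lemma internal_sum_in (I : choiceType) (V : zmodType) (V_ : I -> zmodClosed V)
  i (x : subgrp (V_ i)) : internal_sum V_ (dsum_in x) = val x.
Proof. exact: dsum_lift_in. Qed.

Definition internal_dsum (I : choiceType) (V : zmodType)
    (V_ : I -> zmodClosed V) : Prop :=
  bijective (internal_sum V_).

Record monoid_act (G : monoidType) := MonoidAct {
  act_sort :> choiceType;
  act : G -> act_sort -> act_sort;
  actM : forall g h a, act (g * h)%g a = act g (act h a);
  act1 : forall a, act 1%g a = a }.

Record graded_ring (G : monoidType) := GradedRing {
  gr_ring :> pzRingType;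
  hcomp : G -> zmodClosed gr_ring;
  hcomp_dsum : internal_dsum hcomp;
  hcompM : forall g h s t,
    s \in hcomp g -> t \in hcomp h -> s * t \in hcomp (g * h)%g;
  hcomp1 : 1 \in hcomp 1%g }.

Record category := Category {
  obj :> Type;
  mor : obj -> obj -> Type;
  idc : forall a, mor a a;
  compc : forall a b c, mor b c -> mor a b -> mor a c;
  comp1c : forall a b (f : mor a b), compc (idc b) f = f;
  compc1 : forall a b (f : mor a b), compc f (idc a) = f;
  compcA : forall a b c d (h : mor c d) (g : mor b c) (f : mor a b),
    compc h (compc g f) = compc (compc h g) f }.
Arguments idc {_} _.

Record functor (C D : category) := Functor {
  fobj :> C -> D;
  fmap : forall a b, mor a b -> mor (fobj a) (fobj b);
  fmap1 : forall a, fmap (idc a) = idc (fobj a);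
  fmapM : forall a b c (g : mor b c) (f : mor a b),
    fmap (compc g f) = compc (fmap g) (fmap f) }.

Section FunctorComposition.
Variables C D E : category.

Program Definition functor_id : functor C C :=
  @Functor C C (fun a => a) (fun a b f => f) _ _.

Program Definition functor_comp (F : functor D E) (F' : functor C D) :
  functor C E :=
  @Functor C E (fun a => F (F' a)) (fun a b f => fmap F (fmap F' f)) _ _.
Next Obligation. by rewrite !fmap1. Qed.
Next Obligation. by rewrite !fmapM. Qed.

End FunctorComposition.
Arguments functor_id : clear implicits.

(* Leibniz equality of functors: an isomorphism of categories, not merely an  *)
(* equivalence.                                                               *)
Definition mutually_inverse (C D : category) (F : functor C D)
    (F' : functor D C) : Prop :=
  functor_comp F' F = functor_id C /\ functor_comp F F' = functor_id D.

Record nattrans (C D : category) (F F' : functor C D) := NatTrans {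
  nt :> forall a, mor (F a) (F' a);
  nt_natural : forall a b (f : mor a b),
    compc (nt b) (fmap F f) = compc (fmap F' f) (nt a) }.

Lemma nattrans_eq (C D : category) (F F' : functor C D)
  (eta theta : nattrans F F') : (forall a, eta a = theta a) -> eta = theta.
Proof.
case: eta theta => [eta n] [theta n'] /= e.
have {}e : eta = theta by apply: functional_extensionality_dep.
by case: _ / e n' => n'; rewrite (Prop_irrelevance n n').
Qed.

Section NatTrans.
Variables C D : category.

Program Definition nt_id (F : functor C D) : nattrans F F :=
  NatTrans (nt := fun a => idc (F a)) _.
Next Obligation. by rewrite comp1c compc1. Qed.

Program Definition nt_comp (F F' F'' : functor C D) (eta : nattrans F' F'')
    (theta : nattrans F F') : nattrans F F'' :=
  NatTrans (nt := fun a => compc (eta a) (theta a)) _.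
Next Obligation. by rewrite -compcA nt_natural compcA nt_natural compcA. Qed.

End NatTrans.

Program Definition Ab : category := @Category zmodType
  (fun U V => {additive U -> V}) (fun U => idfun) (fun U V W g f => g \o f) _ _ _.
Next Obligation. exact: additive_eq. Qed.
Next Obligation. exact: additive_eq. Qed.
Next Obligation. exact: additive_eq. Qed.

Record preadditive := Preadditive {
  pobj :> Type;
  phom : pobj -> pobj -> zmodType;
  pid : forall a, phom a a;
  pcomp : forall a b c, phom b c -> phom a b -> phom a c;
  pcomp1c : forall a b (f : phom a b), pcomp (pid b) f = f;
  pcompc1 : forall a b (f : phom a b), pcomp f (pid a) = f;
  pcompA : forall a b c d (h : phom c d) (g : phom b c) (f : phom a b),
    pcomp h (pcomp g f) = pcomp (pcomp h g) f;
  pcompDl : forall a b c (g g' : phom b c) (f : phom a b),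
    pcomp (g + g') f = pcomp g f + pcomp g' f;
  pcompDr : forall a b c (g : phom b c) (f f' : phom a b),
    pcomp g (f + f') = pcomp g f + pcomp g f' }.

Definition preadditive_category (C : preadditive) : category :=
  Category (@pcomp1c C) (@pcompc1 C) (@pcompA C).

Record amodule (C : preadditive) := AModule {
  am_functor :> functor (preadditive_category C) Ab;
  am_additive : forall (a b : C) (f f' : phom a b) x,
    fmap am_functor (f + f') x = fmap am_functor f x + fmap am_functor f' x }.

Definition am_ob (C : preadditive) (M : amodule C) (a : C) : zmodType :=
  fobj M a.
Definition am_map (C : preadditive) (M : amodule C) (a b : C) (f : phom a b) :
  {additive am_ob M a -> am_ob M b} := fmap M f.

Program Definition ModCat (C : preadditive) : category :=
  @Category (amodule C) (fun M N => nattrans M N)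
    (fun M => nt_id M) (fun M N P eta theta => nt_comp eta theta) _ _ _.
Next Obligation. by apply: nattrans_eq => x /=; apply: additive_eq. Qed.
Next Obligation. by apply: nattrans_eq => x /=; apply: additive_eq. Qed.
Next Obligation. by apply: nattrans_eq => x /=; apply: additive_eq. Qed.

Section ActionCategory.
Variables (G : monoidType) (A : monoid_act G) (S : graded_ring G).

Lemma graded_ring_ext (V : zmodType) (f f' : S -> V) :
    zmod_morphism f -> zmod_morphism f' ->
  (forall g s, s \in hcomp S g -> f s = f' s) -> f =1 f'.
Proof.
move=> fB f'B ff' s.
pose F : {additive S -> V} := HB.pack f (GRing.isZmodMorphism.Build _ _ f fB).
pose F' : {additive S -> V} :=
  HB.pack f' (GRing.isZmodMorphism.Build _ _ f' f'B).
have [hdec _ hdecK] := hcomp_dsum S; rewrite -(hdecK s) -[LHS]/(F _) -[RHS]/(F' _).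
elim/dsum_ind: (hdec s) => [|x y IHx IHy|g t]; first by rewrite !raddf0.
  by rewrite !raddfD IHx IHy.
by rewrite internal_sum_in; apply: (ff' g); apply: valP.
Qed.

Definition act_hom_sum (a b : A) :=
  internal_sum (fun g : {g : G | act g a == b} => hcomp S (val g)).

(* The subgroup \bigoplus_(g | ga = b) S_g of S, as the image of the canonical *)
(* map from the external direct sum.                                          *)
Definition act_hom (a b : A) : {pred S} :=
  fun s => `[< exists x, s = act_hom_sum a b x >].

Lemma act_hom_zmod_closed a b : zmod_closed (act_hom a b).
Proof.
split=> [|s t /asboolP[x ->] /asboolP[y ->]]; apply/asboolP.
  by exists 0; rewrite raddf0.
by exists (x - y); rewrite raddfB.
Qed.
HB.instance Definition _ a b :=
  GRing.isZmodClosed.Build S (act_hom a b) (act_hom_zmod_closed a b).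

Lemma hcomp_act_hom g s a b :
  s \in hcomp S g -> act g a = b -> s \in act_hom a b.
Proof.
move=> sg /eqP gab; apply/asboolP.
pose i : {g | act g a == b} := exist _ g gab.
exists (@dsum_in _ (fun g => subgrp (hcomp S (val g))) i (to_subgrp sg)).
by rewrite /act_hom_sum internal_sum_in.
Qed.

Lemma act_hom_ind (P : S -> Prop) a b :
    P 0 ->
    (forall s t, s \in act_hom a b -> t \in act_hom a b ->
       P s -> P t -> P (s + t)) ->
    (forall g s, s \in hcomp S g -> act g a = b -> P s) ->
  forall s, s \in act_hom a b -> P s.
Proof.
move=> P0 PD Ph s /asboolP[x ->]; elim/dsum_ind: x => [|x y Px Py|g t].
- by rewrite raddf0.
- by rewrite raddfD; apply: PD => //; apply/asboolP; [exists x|exists y].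
- rewrite /act_hom_sum internal_sum_in.
  by apply: (Ph (val g)); [apply: valP|apply/eqP/(valP g)].
Qed.

Lemma act_hom1 a : 1 \in act_hom a a.
Proof. by apply: hcomp_act_hom (hcomp1 S) _; rewrite act1. Qed.

Lemma act_homM a b c s t :
  t \in act_hom b c -> s \in act_hom a b -> t * s \in act_hom a c.
Proof.
move=> tbc; elim/act_hom_ind: s / => [|s s' _ _ IH IH'|g s sg gab].
- by rewrite mulr0 rpred0.
- by rewrite mulrDr rpredD.
elim/act_hom_ind: t / tbc => [|t t' _ _ IH IH'|h t th hbc].
- by rewrite mul0r rpred0.
- by rewrite mulrDl rpredD.
by apply: hcomp_act_hom (hcompM th sg) _; rewrite actM gab.
Qed.

(* A morphism a -> b is recorded by its second component only: its source a *)
(* is already determined by the type of the hom group.                      *)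
Program Definition action_category : preadditive :=
  @Preadditive A (fun a b => subgrp (act_hom a b))
    (fun a => to_subgrp (act_hom1 a))
    (fun a b c t s => to_subgrp (act_homM (valP t) (valP s)))
    _ _ _ _ _.
Next Obligation. by apply: val_inj; rewrite /= mul1r. Qed.
Next Obligation. by apply: val_inj; rewrite /= mulr1. Qed.
Next Obligation. by apply: val_inj; rewrite /= mulrA. Qed.
Next Obligation. by apply: val_inj; rewrite /= mulrDl. Qed.
Next Obligation. by apply: val_inj; rewrite /= mulrDr. Qed.

Definition act_mor (a b : A) s (sab : s \in act_hom a b) :
  @phom action_category a b := to_subgrp sab.

End ActionCategory.
Arguments act_hom {G A} S a b.

Section GradedModules.
Variables (G : monoidType) (A : monoid_act G) (S : graded_ring G).

Definition dsum_lmod (M : A -> zmodType)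
    (sc : GRing.Nmodule_isLSemiModule S (dsum M)) : lmodType S :=
  HB.pack (dsum M) sc.

(* A decomposition M = \bigoplus_a M_a is taken literally: the M_a are abelian *)
(* groups, and the S-module structure lives on their external direct sum. See  *)
(* internally_graded below for modules given with a family of subgroups.       *)
Record graded_module := GradedModule {
  gm_comp : A -> zmodType;
  gm_scale : GRing.Nmodule_isLSemiModule S (dsum gm_comp);
  gm_deg : forall g (a : A) s (m : gm_comp a), s \in hcomp S g ->
    exists m' : gm_comp (act g a),
      s *: (dsum_in m : dsum_lmod gm_scale) = dsum_in m' }.

Definition gm_lmod (Q : graded_module) : lmodType S := dsum_lmod (gm_scale Q).
Definition gm_in (Q : graded_module) (a : A) :
  {additive gm_comp Q a -> gm_lmod Q} := dsum_in (i := a).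

Record graded_hom (Q Q' : graded_module) := GradedHom {
  gh_linear :> {linear gm_lmod Q -> gm_lmod Q'};
  gh_deg : forall (a : A) (q : gm_comp Q a),
    exists q' : gm_comp Q' a, gh_linear (gm_in Q a q) = gm_in Q' a q' }.

Lemma linear_eq (U V : lmodType S) (f f' : {linear U -> V}) :
  f =1 f' -> f = f'.
Proof.
case: f f' => [f [[zf] [sf]]] [f' [[zf'] [sf']]] /= /funext e.
case: _ / e zf' sf' => zf' sf'.
by rewrite (Prop_irrelevance zf zf') (Prop_irrelevance sf sf').
Qed.

Lemma graded_hom_eq Q Q' (f f' : graded_hom Q Q') : f =1 f' -> f = f'.
Proof.
case: f f' => [f df] [f' df'] /= e.
have {}e := @linear_eq (gm_lmod Q) (gm_lmod Q') f f' e.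
case: _ / e df' => df'.
by rewrite (Prop_irrelevance df df').
Qed.

Program Definition gh_id Q : graded_hom Q Q := @GradedHom Q Q idfun _.
Next Obligation. by exists q. Qed.

Program Definition gh_comp Q Q' Q'' (f : graded_hom Q' Q'')
  (f' : graded_hom Q Q') : graded_hom Q Q'' := @GradedHom Q Q'' (f \o f') _.
Next Obligation.
have [q' /= ->] := gh_deg f' q; have [q'' /= ->] := gh_deg f q'.
by exists q''.
Qed.

Program Definition GrMod : category :=
  @Category graded_module graded_hom gh_id gh_comp _ _ _.
Next Obligation. exact: graded_hom_eq. Qed.
Next Obligation. exact: graded_hom_eq. Qed.
Next Obligation. exact: graded_hom_eq. Qed.

Lemma gm_ext Q (V : zmodType) (f f' : {additive gm_lmod Q -> V}) :
  (forall a (q : gm_comp Q a), f (gm_in Q a q) = f' (gm_in Q a q)) -> f =1 f'.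
Proof. exact: dsum_ext. Qed.

(* Every S-module V that is the internal direct sum of subgroups V_ a with   *)
(* S_g V_a contained in V_(ga) is identified with a graded_module, the       *)
(* identification being the canonical map from the external direct sum.      *)
Lemma internally_graded (V : lmodType S) (V_ : A -> zmodClosed V) :
    internal_dsum V_ ->
    (forall g (a : A) s v, s \in hcomp S g -> v \in V_ a ->
       s *: v \in V_ (act g a)) ->
  exists (Q : graded_module) (iota : {linear gm_lmod Q -> V}),
    [/\ gm_comp Q = (fun a => subgrp (V_ a)) :> (A -> zmodType),
        bijective iota
      & forall (a : A) v, v \in V_ a <-> exists q, v = iota (gm_in Q a q)].
Proof.
move=> [d dK Kd] Vdeg; pose M (a : A) : zmodType := subgrp (V_ a).
pose sc (s : S) (x : dsum M) : dsum M := d (s *: internal_sum V_ x).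
have dD u v : d (u + v) = d u + d v.
  by apply: (can_inj dK); rewrite raddfD !Kd.
have scA s t x : sc s (sc t x) = sc (s * t) x by rewrite /sc Kd scalerA.
have sc0 x : sc 0 x = 0.
  by apply: (can_inj dK); rewrite Kd scale0r raddf0.
have sc1 : left_id 1 sc by move=> x; rewrite /sc scale1r dK.
have scDr : right_distributive sc +%R.
  by move=> s x y; rewrite /sc raddfD scalerDr dD.
have scDl x : {morph sc^~ x : s t / s + t}.
  by move=> s t; rewrite /sc scalerDl dD.
pose mx : GRing.Nmodule_isLSemiModule S (dsum M) :=
  GRing.Nmodule_isLSemiModule.Build S (dsum M) scA sc0 sc1 scDr scDl.
have deg g (a : A) s (m : M a) : s \in hcomp S g -> exists m' : M (act g a),
    s *: (dsum_in m : dsum_lmod mx) = dsum_in m'.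
  move=> sg; exists (to_subgrp (Vdeg _ _ _ _ sg (valP m))).
  by apply: (can_inj dK); rewrite [LHS]Kd !internal_sum_in.
pose Q := GradedModule deg.
have lin : linear (internal_sum V_ : gm_lmod Q -> V).
  by move=> s x y; rewrite raddfD /= [X in X + _]Kd.
pose iota : {linear gm_lmod Q -> V} := HB.pack (internal_sum V_ : gm_lmod Q -> V)
  (GRing.isLinear.Build S (gm_lmod Q) V *:%R _ lin).
exists Q, iota; split=> //; first by exists d.
move=> a v; split=> [va|[q ->]].
  by exists (to_subgrp va); rewrite [RHS]internal_sum_in.
by rewrite [iota _]internal_sum_in; exact: valP.
Qed.

End GradedModules.

Section Psi.
Variables (G : monoidType) (A : monoid_act G) (S : graded_ring G).
Local Notation AC := (action_category A S).

Section PsiObject.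
Variable Q : graded_module A S.

(* psi_mapE shows that this is q |-> sq, with values in Q_b. *)
Definition psi_map (a b : A) (s : @phom AC a b) (q : gm_comp Q a) :
  gm_comp Q b := (val s *: gm_in Q a q : dsum _) b.

Fact psi_map_is_zmod_morphism a b s : zmod_morphism (@psi_map a b s).
Proof. by move=> q q'; rewrite /psi_map raddfB scalerBr. Qed.
HB.instance Definition _ a b s :=
  GRing.isZmodMorphism.Build _ _ (@psi_map a b s)
    (@psi_map_is_zmod_morphism a b s).

Lemma psi_mapE a b (s : @phom AC a b) q :
  val s *: gm_in Q a q = gm_in Q b (psi_map s q).
Proof.
suff [q' e] : exists q', val s *: gm_in Q a q = gm_in Q b q'.
  by rewrite /psi_map e /= dfwith_in.
case: s => s /=; elim/act_hom_ind: s / => [|s t _ _ [q1 e1] [q2 e2]|g s sg gab].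
- by exists 0; rewrite scale0r raddf0.
- by exists (q1 + q2); rewrite scalerDl e1 e2 raddfD.
- by case: _ / gab; exact: gm_deg.
Qed.

Program Definition psi_functor : functor (preadditive_category AC) Ab :=
  @Functor (preadditive_category AC) Ab (gm_comp Q) psi_map _ _.
Next Obligation.
by apply: additive_eq => q; rewrite /= /psi_map scale1r /= dfwith_in.
Qed.
Next Obligation.
apply: additive_eq => q /=; rewrite [LHS]/psi_map -scalerA.
by rewrite psi_mapE.
Qed.

Program Definition psi_ob : amodule AC := AModule (am_functor := psi_functor) _.
Next Obligation. by rewrite /psi_map scalerDl. Qed.

End PsiObject.

Section PsiMorphism.
Variables (Q Q' : graded_module A S) (h : graded_hom Q Q').

Definition psi_hom_at (a : A) (q : gm_comp Q a) : gm_comp Q' a :=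
  (h (gm_in Q a q) : dsum _) a.

Fact psi_hom_is_zmod_morphism a : zmod_morphism (@psi_hom_at a).
Proof. by move=> q q'; rewrite /psi_hom_at !raddfB. Qed.
HB.instance Definition _ a :=
  GRing.isZmodMorphism.Build _ _ (@psi_hom_at a) (@psi_hom_is_zmod_morphism a).

Lemma psi_hom_atE a q : h (gm_in Q a q) = gm_in Q' a (psi_hom_at q).
Proof.
by rewrite /psi_hom_at; have [q' ->] := gh_deg h q; rewrite /= dfwith_in.
Qed.

Program Definition psi_hom : nattrans (psi_ob Q) (psi_ob Q') :=
  @NatTrans _ _ (psi_ob Q) (psi_ob Q') psi_hom_at _.
Next Obligation.
apply: additive_eq => q /=.
by rewrite [LHS]/psi_hom_at -psi_mapE linearZ/= psi_hom_atE.
Qed.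

End PsiMorphism.

Program Definition Psi : functor (GrMod A S) (ModCat AC) :=
  @Functor (GrMod A S) (ModCat AC) psi_ob psi_hom _ _.
Next Obligation.
by apply: nattrans_eq => x; apply: additive_eq => q; rewrite /= /psi_hom_at/= dfwith_in.
Qed.
Next Obligation.
apply: nattrans_eq => x; apply: additive_eq => q /=.
by rewrite {1}/psi_hom_at /= psi_hom_atE.
Qed.

End Psi.

Section Phi.
Variables (G : monoidType) (A : monoid_act G) (S : graded_ring G).
Local Notation AC := (action_category A S).

Lemma hdec_subproof :
  {d | cancel (internal_sum (hcomp S)) d & cancel d (internal_sum (hcomp S))}.
Proof.
suff /cid[d [dK Kd]] : exists d,
  cancel (internal_sum (hcomp S)) d /\ cancel d (internal_sum (hcomp S)).
  by exists d.
by have [d dK Kd] := hcomp_dsum S; exists d.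
Qed.

Definition hdec : S -> dsum (fun g => subgrp (hcomp S g)) :=
  s2val hdec_subproof.

Lemma hdecK : cancel hdec (internal_sum (hcomp S)).
Proof. exact: s2valP' hdec_subproof. Qed.

Lemma internal_sumK : cancel (internal_sum (hcomp S)) hdec.
Proof. exact: s2valP hdec_subproof. Qed.

Fact hdec_is_zmod_morphism : zmod_morphism hdec.
Proof.
move=> s t; apply: (can_inj internal_sumK).
by rewrite raddfB !hdecK.
Qed.
HB.instance Definition _ :=
  GRing.isZmodMorphism.Build _ _ hdec hdec_is_zmod_morphism.

Lemma hdec_hcomp g s (sg : s \in hcomp S g) : hdec s = dsum_in (to_subgrp sg).
Proof. by apply: (can_inj internal_sumK); rewrite hdecK internal_sum_in. Qed.

Section PhiObject.
Variable M : amodule AC.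
Local Notation dM := (dsum (am_ob M : A -> zmodType)).

Definition phi_in (a : A) : {additive am_ob M a -> dM} := dsum_in (i := a).

Lemma am_map_is_zmod_morphism (a b : A) (m : am_ob M a) :
  zmod_morphism (fun s : @phom AC a b => am_map M s m).
Proof.
pose f (s : @phom AC a b) := am_map M s m.
have fD (s t : @phom AC a b) : f (s + t) = f s + f t by exact: am_additive.
by move=> s t; apply: (addIr (f t)); rewrite -[LHS]fD !subrK.
Qed.
Definition am_ev (a b : A) (m : am_ob M a) (s : @phom AC a b) := am_map M s m.
HB.instance Definition _ a b m :=
  GRing.isZmodMorphism.Build (@phom AC a b) (am_ob M b) (@am_ev a b m)
    (@am_map_is_zmod_morphism a b m).

Definition hmor g (a : A) (s : subgrp (hcomp S g)) : @phom AC a (act g a) :=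
  act_mor (hcomp_act_hom (valP s) erefl).

Fact hmor_is_zmod_morphism g a : zmod_morphism (@hmor g a).
Proof. by move=> s t; apply: val_inj. Qed.
HB.instance Definition _ g a :=
  GRing.isZmodMorphism.Build _ _ (@hmor g a) (@hmor_is_zmod_morphism g a).

Definition phi_hscale g (s : subgrp (hcomp S g)) : {additive dM -> dM} :=
  dsum_lift (fun a => phi_in (act g a) \o am_map M (hmor a s)).

Lemma phi_hscale_in g s a m :
  @phi_hscale g s (phi_in a m) = phi_in (act g a) (am_map M (hmor a s) m).
Proof. exact: dsum_lift_in. Qed.

Definition phi_hscale_ev (x : dM) g (s : subgrp (hcomp S g)) := phi_hscale s x.

Fact phi_hscale_is_zmod_morphism x g : zmod_morphism (@phi_hscale_ev x g).
Proof.
move=> s t; rewrite /phi_hscale_ev; elim/dsum_ind: x => [|x y IHx IHy|a m].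
- by rewrite !raddf0 addr0.
- by rewrite !raddfD IHx IHy addrACA.
rewrite !phi_hscale_in -raddfB; congr (phi_in _ _).
by rewrite raddfB; exact: am_map_is_zmod_morphism.
Qed.
HB.instance Definition _ x g :=
  GRing.isZmodMorphism.Build _ _ (@phi_hscale_ev x g)
    (@phi_hscale_is_zmod_morphism x g).

(* s = \sum_g s_g acts as the sum of the actions of the s_g; these are         *)
(* determined on m in M(a) by phi_scale_hcomp.                                 *)
Definition phi_scale (s : S) (x : dM) : dM :=
  dsum_lift (fun g => @phi_hscale_ev x g) (hdec s).

Fact phi_scaleBl x : zmod_morphism (phi_scale^~ x).
Proof. by move=> s t; rewrite /phi_scale !raddfB. Qed.

Fact phi_scaleBr s : zmod_morphism (phi_scale s).
Proof.
move=> x y; rewrite /phi_scale; elim/dsum_ind: (hdec s) => [|d d' IH IH'|g t].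
- by rewrite !raddf0 addr0.
- rewrite raddfD [X in _ = X - _]raddfD [X in _ = _ - X]raddfD /= IH IH'.
  by rewrite opprD addrACA.
by rewrite !dsum_lift_in /= /phi_hscale_ev raddfB.
Qed.

Definition phi_scale_ev x s := phi_scale s x.
HB.instance Definition _ s :=
  GRing.isZmodMorphism.Build _ _ (phi_scale s) (phi_scaleBr s).
HB.instance Definition _ x :=
  GRing.isZmodMorphism.Build _ _ (phi_scale_ev x) (phi_scaleBl x).

Lemma phi_scale_hom (a b : A) (s : @phom AC a b) m :
  phi_scale (val s) (phi_in a m) = phi_in b (am_map M s m).
Proof.
suff H t : t \in act_hom S a b -> forall s : @phom AC a b, val s = t ->
    phi_scale t (phi_in a m) = phi_in b (am_map M s m).
  exact: H (valP s) s erefl.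
elim/act_hom_ind => {s t} [|t t' tab tab' IH IH'|g t tg gab] s st.
- have -> : s = 0 by apply: val_inj.
  by rewrite [LHS](raddf0 (phi_scale_ev _)) -/(am_ev m 0) !raddf0.
- have -> : s = act_mor tab + act_mor tab' by apply: val_inj.
  rewrite [LHS](raddfD (phi_scale_ev _)) -/(am_ev m _) !raddfD.
  by congr (_ + _); [exact: IH|exact: IH'].
- rewrite /phi_scale (hdec_hcomp tg) dsum_lift_in /= /phi_hscale_ev phi_hscale_in.
  case: _ / gab s st => s st; congr (phi_in _ (am_map M _ _)).
  exact: val_inj.
Qed.

Lemma phi_scale_hcomp g s (sg : s \in hcomp S g) a m :
  phi_scale s (phi_in a m) =
  phi_in (act g a) (am_map M (act_mor (hcomp_act_hom sg erefl)) m).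
Proof. exact: (phi_scale_hom (act_mor (hcomp_act_hom sg erefl))). Qed.

Fact phi_scaleDr : right_distributive phi_scale +%R.
Proof. by move=> s x y; rewrite raddfD. Qed.

Fact phi_scaleA s t x : phi_scale s (phi_scale t x) = phi_scale (s * t) x.
Proof.
elim/dsum_ind: x s t => [|x y IHx IHy|a m] s t; first by rewrite !raddf0.
  by rewrite !phi_scaleDr IHx IHy.
pose lhs u := phi_scale s (phi_scale u (phi_in a m)).
pose rhs u := phi_scale (s * u) (phi_in a m).
apply: (@graded_ring_ext _ _ _ lhs rhs) => {t}.
- by move=> t t'; rewrite /lhs phi_scaleBl raddfB.
- by move=> t t'; rewrite /rhs mulrBr phi_scaleBl.
move=> h t th; rewrite /lhs /rhs {lhs rhs} (phi_scale_hcomp th).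
set b := act h a; set m' := am_map _ _ _.
pose lhs u := phi_scale u (phi_in b m').
pose rhs u := phi_scale (u * t) (phi_in a m).
apply: (@graded_ring_ext _ _ _ lhs rhs) => {s}.
- by move=> s s'; rewrite /lhs phi_scaleBl.
- by move=> s s'; rewrite /rhs mulrBl phi_scaleBl.
move=> g s sg; rewrite /lhs /rhs {lhs rhs} (phi_scale_hcomp sg).
have sab := hcomp_act_hom sg (erefl (act g b)).
have tab : t \in act_hom S a b by exact: hcomp_act_hom th erefl.
have /= -> := phi_scale_hom (act_mor (act_homM sab tab)) m.
congr (phi_in _ _); rewrite /m'.
transitivity (fmap M (@compc (preadditive_category AC) a b (act g b)
  (act_mor sab) (act_mor tab)) m).
  rewrite fmapM /am_map /=; congr (fmap M _ (fmap M _ m)); exact: val_inj.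
by congr (fmap M _ m); apply: val_inj.
Qed.

Fact phi_scale1 : left_id 1 phi_scale.
Proof.
elim/dsum_ind => [|x y IHx IHy|a m]; first by rewrite !raddf0.
  by rewrite !phi_scaleDr IHx IHy.
have /= -> := phi_scale_hom (act_mor (act_hom1 S a)) m.
congr (phi_in _ _).
have /(congr1 (fun k : {additive _ -> _} => k m)) /= e := @fmap1 _ _ M a.
exact: e.
Qed.

Fact phi_scale0 x : phi_scale 0 x = 0.
Proof. exact: (raddf0 (phi_scale_ev x)). Qed.

Fact phi_scaleDl x : {morph phi_scale^~ x : s t / s + t}.
Proof. exact: (raddfD (phi_scale_ev x)). Qed.

Definition phi_lmod : GRing.Nmodule_isLSemiModule S dM :=
  GRing.Nmodule_isLSemiModule.Build S dM
    phi_scaleA phi_scale0 phi_scale1 phi_scaleDr phi_scaleDl.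

Program Definition phi_ob : graded_module A S :=
  @GradedModule _ A S (am_ob M) phi_lmod _.
Next Obligation.
exists (am_map M (act_mor (hcomp_act_hom H erefl)) m).
exact: phi_scale_hcomp.
Qed.

End PhiObject.

Section PhiMorphism.
Variables (M N : amodule AC) (f : nattrans M N).

Definition nt_at (a : A) : {additive am_ob M a -> am_ob N a} := nt f a.

Lemma phi_map_finite (x : gm_lmod (phi_ob M)) :
  finite_set [set a | nt_at a ((x : dsum _) a) != 0].
Proof.
apply: sub_finite_set (dsum_finite (x : dsum _)) => a /=.
by apply: contra_neq => ->; rewrite raddf0.
Qed.

Definition phi_map (x : gm_lmod (phi_ob M)) : gm_lmod (phi_ob N) :=
  DSum (phi_map_finite x).

Fact phi_map_is_zmod_morphism : zmod_morphism phi_map.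
Proof. by move=> x y; apply: dsumP => a; rewrite /= raddfB. Qed.
HB.instance Definition _ :=
  GRing.isZmodMorphism.Build _ _ phi_map phi_map_is_zmod_morphism.

Lemma phi_map_in a m :
  phi_map (phi_in M a m) = phi_in N a (nt_at a m).
Proof.
apply: dsumP => b /=; have [->|ba] := eqVneq b a; first by rewrite !dfwith_in.
by rewrite !dfwith_out ?raddf0// eq_sym.
Qed.

Fact phi_map_scalable : scalable phi_map.
Proof.
move=> s x; change (phi_map (phi_scale s x) = phi_scale s (phi_map x)).
have phi_mapD (y z : dsum _) :
  phi_map (y + z) = (phi_map y + phi_map z : dsum _) by exact: raddfD.
have phi_map0 : phi_map (0 : dsum _) = (0 : dsum _) by exact: raddf0.
elim/dsum_ind: x s => [|x y IHx IHy|a m] s.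
- by rewrite raddf0 phi_map0 raddf0.
- by rewrite phi_scaleDr !phi_mapD IHx IHy phi_scaleDr.
pose lhs t := phi_map (phi_scale t (phi_in M a m)).
pose rhs t := phi_scale t (phi_map (phi_in M a m)).
apply: (@graded_ring_ext _ _ _ lhs rhs) => {s}.
- by move=> s s'; rewrite /lhs phi_scaleBl raddfB.
- by move=> s s'; rewrite /rhs phi_scaleBl.
move=> g s sg; rewrite /lhs /rhs phi_map_in !(phi_scale_hcomp sg) phi_map_in.
congr (phi_in _ _ _).
set u := act_mor _.
have := @nt_natural _ _ _ _ f a (act g a) u.
by move=> /(congr1 (fun k : {additive _ -> _} => k m)).
Qed.
HB.instance Definition _ :=
  GRing.isScalable.Build S (gm_lmod (phi_ob M)) (gm_lmod (phi_ob N)) *:%R phi_map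
    phi_map_scalable.

Program Definition phi_hom : graded_hom (phi_ob M) (phi_ob N) :=
  @GradedHom _ _ _ (phi_ob M) (phi_ob N) phi_map _.
Next Obligation. by exists (nt_at a q); exact: phi_map_in. Qed.

End PhiMorphism.

Program Definition Phi : functor (ModCat AC) (GrMod A S) :=
  @Functor (ModCat AC) (GrMod A S) phi_ob phi_hom _ _.
Next Obligation. by apply: graded_hom_eq => x; apply: dsumP. Qed.
Next Obligation. by apply: graded_hom_eq => x; apply: dsumP. Qed.

End Phi.

(* Main.v *)
(* Both composites fix objects and morphisms on the nose at the level of        *)
(* components; the only content is that the S-action rebuilt from the functor   *)
(* of a graded module is the original one, which by additivity is checked on    *)
(* homogeneous scalars and homogeneous elements. Since the objects of the two   *)
(* composites are only propositionally equal to the original ones, equality of  *)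
(* functors is expressed through the identity morphisms transported along these *)
(* equalities, and proof irrelevance shows that they act as identities.         *)
Require Import Defs.
From mathcomp Require Import all_boot all_order all_algebra.
From mathcomp Require Import boolp.

Set Implicit Arguments.
Unset Strict Implicit.
Unset Printing Implicit Defensive.
Import GRing.Theory.
Local Open Scope ring_scope.

(** Both kinds of object carry the same data: groups indexed by [A], with homogeneous scalars [s] of
    degree [g] mapping the group at [a] to the one at [act g a], compatibly with sums and products.
    [psi_phi_ob] and [phi_psi_ob] recover each object from these data; [functor_eq] then leaves only
    a check on morphisms. *)

Definition eq_mor (C : category) (x y : C) (e : x = y) : mor x y :=
  match e in _ = z return mor x z with erefl => idc x end.

Lemma eq_mor_refl (C : category) (x : C) (e : x = x) : eq_mor e = idc x.
Proof. by rewrite (Prop_irrelevance e erefl). Qed.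

(** The square with [eq_mor] replaces an equality of morphisms of different types; once [F] and [F']
    agree on objects, both [eq_mor] are identities. *)
Lemma functor_eq (C D : category) (F F' : functor C D)
    (e : forall a, F a = F' a) :
    (forall a b (f : mor a b),
       compc (eq_mor (e b)) (fmap F f) = compc (fmap F' f) (eq_mor (e a))) ->
  F = F'.
Proof.
case: F F' e => [F m m1 mM] [F' m' m1' mM'] /= e.
have eF : F = F' by apply/funext.
case: _ / eF m' m1' mM' e => m' m1' mM' e me.
have {}me : m = m'.
  apply: functional_extensionality_dep => a.
  apply: functional_extensionality_dep => b.
  apply/funext => f; have := me a b f.
  by rewrite !eq_mor_refl comp1c compc1.
case: _ / me m1' mM' => m1' mM'.
by rewrite (Prop_irrelevance m1 m1') (Prop_irrelevance mM mM').
Qed.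

Lemma amodule_eq (C : preadditive) (M N : amodule C) :
  am_functor M = am_functor N -> M = N.
Proof.
case: M N => [F aF] [F' aF'] /= e; case: _ / e aF' => aF'.
by rewrite (Prop_irrelevance aF aF').
Qed.

Lemma eq_mor_amodule (C : preadditive) (M N : ModCat C) (e : M = N) (a : C) :
  (eq_mor e : nattrans _ _) a =
  eq_mor (congr1 (fun P : amodule C => fobj P a) e).
Proof. by case: _ / e. Qed.

Lemma lmod_mixin_eq (R : pzSemiRingType) (V : nmodType)
    (m m' : GRing.Nmodule_isLSemiModule R V) :
  GRing.Nmodule_isLSemiModule.scale m =2 GRing.Nmodule_isLSemiModule.scale m' ->
  m = m'.
Proof.
case: m m' => [s a b c d f] [s' a' b' c' d' f'] /= e.
have {}e : s = s' by apply/funext => x; apply/funext => y.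
case: _ / e a' b' c' d' f' => a' b' c' d' f'.
by congr GRing.Nmodule_isLSemiModule.Axioms_; apply: Prop_irrelevance.
Qed.

Section Graded.
Variables (G : monoidType) (A : monoid_act G) (S : graded_ring G).

Lemma graded_module_eq (M : A -> zmodType)
    (sc sc' : GRing.Nmodule_isLSemiModule S (dsum M)) deg deg' :
  GRing.Nmodule_isLSemiModule.scale sc =2
    GRing.Nmodule_isLSemiModule.scale sc' ->
  GradedModule (gm_scale := sc) deg = GradedModule (gm_scale := sc') deg'.
Proof.
move=> /lmod_mixin_eq e; case: _ / e deg' => deg'.
by rewrite (Prop_irrelevance deg deg').
Qed.

(** The transport sees only the component families, not the scalings, so it is trivial whenever the
    families coincide. *)
Lemma eq_mor_graded (Q Q' : GrMod A S) (e : Q = Q') (x : gm_lmod Q) :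
  (eq_mor e : graded_hom _ _) x =
  eq_rect _ (fun M : A -> zmodType => dsum M) x _ (congr1 (@gm_comp G A S) e).
Proof. by case: _ / e. Qed.

(** By [phi_scale_hom], every [s] in [act_hom S a b], homogeneous or not, acts on the summand at [a]
    as [M] does. *)
Lemma psi_phi_ob (M : amodule (action_category A S)) :
  psi_ob (phi_ob M) = M.
Proof.
apply: amodule_eq.
apply: (@functor_eq _ _ (psi_functor (phi_ob M)) M (fun=> erefl)) => a b s.
rewrite comp1c compc1; apply: additive_eq => m /=.
rewrite -[LHS]/(phi_scale (val s) (phi_in M a m) b).
by rewrite phi_scale_hom /= dfwith_in.
Qed.

Lemma phi_psi_ob (Q : graded_module A S) : phi_ob (psi_ob Q) = Q.
Proof.
rewrite /phi_ob; case: Q => M sc deg; apply: graded_module_eq => s x.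
set Q := GradedModule deg.
rewrite -[LHS]/(phi_scale s (x : dsum (am_ob (psi_ob Q))))
  -[RHS]/(s *: (x : gm_lmod Q) : gm_lmod Q).
elim/dsum_ind: x s => [|x y IHx IHy|a m] s.
- by rewrite raddf0 [RHS](scaler0 (gm_lmod Q) s).
- by rewrite phi_scaleDr IHx IHy [RHS](scalerDr s (x : gm_lmod Q)).
(* With [m] fixed, both sides are additive in the scalar, so homogeneous scalars suffice. *)
pose lhs t := phi_scale t (phi_in (psi_ob Q) a m).
pose rhs t : dsum M := t *: gm_in Q a m.
apply: (@graded_ring_ext _ _ _ lhs rhs) => {s}.
- exact: phi_scaleBl.
- by move=> s t; rewrite /rhs scalerBl.
move=> g s sg; rewrite /lhs /rhs (phi_scale_hcomp sg).
have sga := hcomp_act_hom sg (erefl (act g a)).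
exact: esym (@psi_mapE G A S Q a (act g a) (act_mor sga) m).
Qed.

End Graded.

Theorem theorem2p9 (G : monoidType) (A : monoid_act G) (S : graded_ring G) :
  mutually_inverse
    (Phi A S : functor (ModCat (action_category A S)) (GrMod A S))
    (Psi A S : functor (GrMod A S) (ModCat (action_category A S))).
Proof.
split.
  apply: (functor_eq (F := functor_comp (Psi A S) (Phi A S))
    (F' := functor_id _) (e := @psi_phi_ob G A S)) => M N f.
  apply: nattrans_eq => a /=; rewrite !eq_mor_amodule.
  (* The groups at [a] before and after the round trip are convertible, so the transport is an
     identity. *)
  have idE (P : amodule _) := eq_mor_refl (congr1
    (fun P : amodule _ => fobj P a) (@psi_phi_ob G A S P) : fobj P a = fobj P a).
  rewrite [eq_mor _](idE N) [eq_mor _](idE M).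
  apply: additive_eq => m /=.
  by rewrite /psi_hom_at /= dfwith_in.
apply: (functor_eq (F := functor_comp (Phi A S) (Psi A S))
  (F' := functor_id _) (e := @phi_psi_ob G A S)) => Q Q' h.
apply: graded_hom_eq => x /=; rewrite !eq_mor_graded.
(* The component families are convertible here too, although the scalings are only provably
   equal. *)
have irr P := Prop_irrelevance (congr1 (@gm_comp G A S) (phi_psi_ob P))
  (erefl (gm_comp P)).
rewrite (irr Q) (irr Q') /=.
pose lhs (y : dsum (gm_comp Q)) : dsum (gm_comp Q') := phi_map (psi_hom h) y.
pose rhs (y : dsum (gm_comp Q)) : dsum (gm_comp Q') := h y.
rewrite -[LHS]/(lhs x) -[RHS]/(rhs x).
have lhsD : {morph lhs : y z / y + z} by exact: raddfD (phi_map (psi_hom h)).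
have rhsD : {morph rhs : y z / y + z} by exact: raddfD h.
elim/dsum_ind: x => [|x y IHx IHy|a m].
- by rewrite /lhs /rhs [LHS](raddf0 (phi_map (psi_hom h))) [RHS](raddf0 h).
- by rewrite lhsD rhsD IHx IHy.
- by rewrite [LHS](phi_map_in (psi_hom h)); exact/esym/psi_hom_atE.
Qed.
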